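(* Let $M$ be a Turing machine with binary input alphabet $\{0,1\}$. Then there exist a finite diagram $(\mathcal{S},\mathcal{S}',\mathcal{M})$ generated by $\mathcal{M}_{\mathbb{N}}=\{0,\mathrm{succ}\}$, containing a member equal to $\mathbf{1}$, and two members $S=\mathbb{N}\times\mathbb{N}$ and $T=\mathbb{N}\times\mathbb{N}$ of $\mathcal{S}$, such that the data $(\mathcal{S},\mathcal{S}',\mathcal{M},\{\mathbf{1}\},s_{\mathbf{1}},S,T)$ represents a map $\bar{M}:\mathbf{2}^{\mathbb{N}\times\mathbb{N}}\to\mathbf{2}^{\mathbb{N}\times\mathbb{N}}$ with the following property: for every binary string $\sigma$, $\bar{M}(\bar{\sigma})=\bar{\tau}$ if $M$ accepts $\sigma$ leaving the binary string $\tau$ on its tape, and $\bar{M}(\bar{\sigma})=\emptyset$ if $M$ rejects $\sigma$ or does not terminate on input $\sigma$.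
   Context: Notation: $\mathbf{1}=\{0\}$, $\mathbf{2}=\{0,1\}$, $\mathbb{N}=\{0,1,2,\dots\}$; $\mathbf{2}^X$ is the power set of $X$. For $x\in X$ the same letter denotes the constant map $\mathbf{1}\to X$, $0\mapsto x$. For a map $f:X\to Y$, $f$ also denotes the direct-image map $\mathbf{2}^X\to\mathbf{2}^Y$, and $f^{-1}:\mathbf{2}^Y\to\mathbf{2}^X$ denotes the preimage map. Diagrams: a diagram is a triple $(\mathcal{S},\mathcal{S}',\mathcal{M})$ where $\mathcal{S}$ is an indexed family of sets (members with distinct indices are treated as distinct even if equal as sets), $\mathcal{S}'$ is a subfamily of $\mathcal{S}$, and $\mathcal{M}$ is an indexed family of maps each of the form $\varphi:\mathbf{2}^{\mathrm{dm}(\varphi)}\to\mathbf{2}^{\mathrm{cdm}(\varphi)}$ with $\mathrm{dm}(\varphi),\mathrm{cdm}(\varphi)\in\mathcal{S}$. It is finite if $\mathcal{S}$ and $\mathcal{M}$ are finite. For $T\in\mathcal{S}$ let $\mathrm{in}(T)=\{\varphi\in\mathcal{M}:\mathrm{cdm}(\varphi)=T\}$. A cross section of the diagram is an assignment $s$ of a subset $s(X)\subseteq X$ to each $X\in\mathcal{S}$ such that for every $X$ with $\mathrm{in}(X)\neq\emptyset$: $s(X)=\bigcap_{\varphi\in\mathrm{in}(X)}\varphi(s(\mathrm{dm}(\varphi)))$ if $X\notin\mathcal{S}'$, and $s(X)=\bigcup_{\varphi\in\mathrm{in}(X)}\varphi(s(\mathrm{dm}(\varphi)))$ if $X\in\mathcal{S}'$.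 Let $s_{\mathbf{1}}$ be the partial assignment giving the member $\mathbf{1}$ the subset $\mathbf{1}$, and let $\Gamma(\mathcal{S},\mathcal{S}',\mathcal{M}\mid s_{\mathbf{1}})$ be the set of cross sections $s$ with $s(\mathbf{1})=\mathbf{1}$. The data $(\mathcal{S},\mathcal{S}',\mathcal{M},\{\mathbf{1}\},s_{\mathbf{1}},X,Y)$ (with $X,Y\in\mathcal{S}$) represents a map $\psi:\mathbf{2}^X\to\mathbf{2}^Y$ if every $s\in\Gamma(\mathcal{S},\mathcal{S}',\mathcal{M}\mid s_{\mathbf{1}})$ satisfies $s(Y)=\psi(s(X))$. Generated diagrams: for a set $\mathcal{M}_{\mathrm{S}}$ of maps, $\langle\mathcal{M}_{\mathrm{S}}\rangle$ is the smallest class of maps containing $\mathcal{M}_{\mathrm{S}}$, all identity maps, all maps $\omega:X\to\mathbf{1}$, and all projections of finite Cartesian products onto a factor, and closed under composition and under forming product maps $f_1\times\cdots\times f_n:X\to Y_1\times\cdots\times Y_n$, $x\mapsto(f_1(x),\dots,f_n(x))$. A diagram is generated by $\mathcal{M}_{\mathrm{S}}$ if each map in $\mathcal{M}$ is the direct-image map $f$ or the preimage map $f^{-1}$ of some $f\in\langle\mathcal{M}_{\mathrm{S}}\rangle$. Here $\mathcal{M}_{\mathbb{N}}=\{0,\mathrm{succ}\}$ with $0:\mathbf{1}\to\mathbb{N}$ the constant map and $\mathrm{succ}:\mathbb{N}\to\mathbb{N}$, $n\mapsto n+1$. Encoding of strings: a binary string $\sigma=\sigma[0]\sigma[1]\cdots\sigma[|\sigma|-1]$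 (with $\sigma[i]\in\{0,1\}\subseteq\mathbb{N}$) is encoded by $\bar{\sigma}=\{(i,\sigma[i]):0\le i\le|\sigma|-1\}\cup\{(|\sigma|,0),(|\sigma|,1)\}\subseteq\mathbb{N}\times\mathbb{N}$. Turing machines are standard single-tape machines $(Q,\{0,1\},\Theta,\text{blank},\delta,q_0,q_{\mathrm{A}},q_{\mathrm{R}})$ with finite state set $Q$, finite tape alphabet $\Theta\supseteq\{0,1\}$, transition function $\delta:\Theta\times Q\to\Theta\times Q\times\{\text{left},\text{right}\}$, initial, accept and reject states. *)

(* Defs.v *)
From mathcomp Require Import all_boot.
From mathcomp Require Import boolp classical_sets cardinality.

Set Implicit Arguments.
Unset Strict Implicit.
Unset Printing Implicit Defensive.

Local Open Scope classical_set_scope.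

(** * Diagrams *)

(* Families are indexed, so members (or maps) with distinct indices are distinct
   even when they are equal as sets (or as maps).  The family of maps is
   presented by its fibres over (domain, codomain): [darr X Y] indexes the
   members of the family that are maps from subsets of X to subsets of Y, and
   the whole index set is [{X & {Y & darr X Y}}].  [dunion] is the subfamily of
   members at which incoming values are united instead of intersected. *)
Record diagram := Diagram {
  didx : Type;
  dset : didx -> Type;
  dunion : set didx;
  darr : didx -> didx -> Type;
  dmap : forall X Y : didx, darr X Y -> set (dset X) -> set (dset Y)
}.

Definition finite_diagram (D : diagram) : Prop :=
  finite_set [set: didx D] /\
  finite_set [set: {X : didx D & {Y : didx D & darr X Y}}].

Definition incoming (D : diagram) (Y : didx D) : Type :=
  {X : didx D & darr X Y}.

Definition assignment (D : diagram) : Type := forall X : didx D, set (dset X).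

Definition incoming_value (D : diagram) (s : assignment D) (Y : didx D)
    (a : incoming Y) : set (dset Y) :=
  dmap (projT2 a) (s (projT1 a)).

Definition cross_section (D : diagram) (s : assignment D) : Prop :=
  forall Y : didx D, inhabited (incoming Y) ->
    (~ dunion Y ->
       s Y = \bigcap_(a in [set: incoming Y]) incoming_value s a) /\
    (dunion Y ->
       s Y = \bigcup_(a in [set: incoming Y]) incoming_value s a).

(* A member of D that is equal, as a set, to A. *)
Record member (D : diagram) (A : Type) := Member {
  midx : didx D;
  midxE : dset midx = A
}.

(* The value s(X), read as a subset of the set A that X is equal to. *)
Definition value_at (D : diagram) (A : Type) (s : assignment D)
    (X : member D A) : set A :=
  ecast T (set T) (midxE X) (s (midx X)).

(* The one-element set {0} is [unit]. *)
Definition sections_with_one (D : diagram) (one : member D unit) :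
    set (assignment D) :=
  [set s | cross_section s /\ value_at s one = [set: unit]].

Definition represents (D : diagram) (one : member D unit) (A B : Type)
    (X : member D A) (Y : member D B) (psi : set A -> set B) : Prop :=
  forall s, sections_with_one one s -> value_at s Y = psi (value_at s X).

(** * Generated diagrams *)

Definition map_class := forall X Y : Type, set (X -> Y).

(* Finite Cartesian products are iterated binary products, so that n-ary
   projections and n-ary product maps are composed of binary ones. *)
Inductive generated (MS : map_class) : forall X Y : Type, (X -> Y) -> Prop :=
| gen_base (X Y : Type) (f : X -> Y) : MS X Y f -> generated MS f
| gen_id (X : Type) : generated MS (fun x : X => x)
| gen_omega (X : Type) : generated MS (fun _ : X => tt)
| gen_fst (X Y : Type) : generated MS (fun p : X * Y => p.1)
| gen_snd (X Y : Type) : generated MS (fun p : X * Y => p.2)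
| gen_comp (X Y Z : Type) (f : X -> Y) (g : Y -> Z) :
    generated MS f -> generated MS g -> generated MS (fun x => g (f x))
| gen_pair (X Y Z : Type) (f : X -> Y) (g : X -> Z) :
    generated MS f -> generated MS g -> generated MS (fun x => (f x, g x)).

Definition diagram_generated_by (MS : map_class) (D : diagram) : Prop :=
  forall (X Y : didx D) (a : darr X Y),
    (exists2 f : dset X -> dset Y,
       generated MS f & forall A, dmap a A = f @` A) \/
    (exists2 f : dset Y -> dset X,
       generated MS f & forall A, dmap a A = f @^-1` A).

Inductive M_N : map_class :=
| M_N_zero : M_N (fun _ : unit => 0)
| M_N_succ : M_N succn.

(** * Encoding of binary strings *)

Definition encode (sigma : seq bool) : set (nat * nat) :=
  [set (i, nat_of_bool (nth false sigma i)) | i in [set i | i < size sigma]]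
  `|` [set (size sigma, 0); (size sigma, 1)].

(** * Turing machines *)

Inductive direction := Left | Right.

Record turing_machine := TuringMachine {
  tm_state : finType;
  tm_sym : finType;
  tm_bit : bool -> tm_sym; (* the inclusion of the input alphabet *)
  tm_bit_inj : injective tm_bit;
  tm_blank : tm_sym;
  tm_blankP : forall b, tm_bit b <> tm_blank;
  tm_delta : tm_sym * tm_state -> tm_sym * tm_state * direction;
  tm_start : tm_state;
  tm_accept : tm_state;
  tm_reject : tm_state;
  tm_accept_neq_reject : tm_accept <> tm_reject
}.

Section Run.

Variable M : turing_machine.

(* The tape is infinite to the right only. *)
Record config := Config {
  c_state : tm_state M;
  c_head : nat;
  c_tape : nat -> tm_sym M
}.

Definition tape_of (sigma : seq bool) : nat -> tm_sym M :=
  fun i => if i < size sigma then tm_bit M (nth false sigma i) else tm_blank M.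

Definition initial_config (sigma : seq bool) : config :=
  Config (tm_start M) 0 (tape_of sigma).

Definition halted (c : config) : bool :=
  (c_state c == tm_accept M) || (c_state c == tm_reject M).

(* Halted configurations are fixed; a left move at cell 0 leaves the head there. *)
Definition step (c : config) : config :=
  if halted c then c
  else
    let: (x, q, d) := tm_delta (c_tape c (c_head c), c_state c) in
    Config q
      (match d with Left => (c_head c).-1 | Right => (c_head c).+1 end)
      (fun i => if i == c_head c then x else c_tape c i).

Definition run (sigma : seq bool) (n : nat) : config :=
  iter n step (initial_config sigma).

(* The whole tape of the accepting configuration is tau followed by blanks. *)
Definition accepts_leaving (sigma tau : seq bool) : Prop :=
  exists n, c_state (run sigma n) = tm_accept M /\
            c_tape (run sigma n) =1 tape_of tau.

Definition rejects (sigma : seq bool) : Prop :=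
  exists n, c_state (run sigma n) = tm_reject M.

Definition does_not_terminate (sigma : seq bool) : Prop :=
  forall n, ~~ halted (run sigma n).

End Run.

(* Main.v *)
Require Import Defs.
From mathcomp Require Import all_boot.
From mathcomp Require Import boolp classical_sets cardinality.

Local Open Scope classical_set_scope.

Set Implicit Arguments.
Unset Strict Implicit.
Unset Printing Implicit Defensive.

(** The space-time diagram of a run satisfies positive existential equations:
    each cell content and head position at time t+1 is obtained by images,
    preimages, unions and intersections from those at time t.  "The head is
    elsewhere" is made positive by means of the relation i <> j, and the end of
    a string is visible without complements because its cell carries both bits.
    For an arbitrary input set, a solution of such a monotone system exists by
    Knaster-Tarski, and it is unique because every map increases the pair
    (level of the member, rank) in the lexicographic order, time being the rank
    of the recursive members.  Hence the output is a function of the input, and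
    for an encoded string it can be read off the actual run, which is a
    solution. *)

(** * Boolean quantifiers and membership in encoded strings *)

Lemma forall_bool (P : bool -> Prop) : (forall b, P b) <-> P true /\ P false.
Proof. by split=> [Pb|[Pt Pf] []]. Qed.

Lemma exists_bool (P : bool -> Prop) : (exists b, P b) <-> P true \/ P false.
Proof. by split=> [[[] Pb]|[Pt|Pf]]; [left|right|exists true|exists false]. Qed.

Lemma encodeE (sigma : seq bool) (i : nat) (b : bool) :
  encode sigma (i, nat_of_bool b) <->
  (i < size sigma /\ nth false sigma i = b) \/ i = size sigma.
Proof.
split.
  case=> [[j /= ltj [<- e]]|[[-> _]|[-> _]]]; [left|by right|by right].
  by split=> //; case: (nth _ _ _) e; case: b.
case=> [[lti <-]|->]; first by left; exists i.
by right; case: b; [right|left].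
Qed.

Lemma encode_snd (sigma : seq bool) (i c : nat) :
  encode sigma (i, c) -> exists b, c = nat_of_bool b.
Proof.
case=> [[j _ [_ <-]]|[[_ ->]|[_ ->]]]; first by exists (nth false sigma j).
  by exists false.
by exists true.
Qed.

(** * Diagrams presented as systems of monotone set equations *)

Section System.

Variables (node : Type) (ty : node -> Type) (lab : node -> finType).

Inductive link (Y : node) : Type :=
| Image (X : node) (f : ty X -> ty Y)
| Preimage (X : node) (f : ty Y -> ty X).

Variables (joins : node -> bool) (links : forall Y, lab Y -> link Y).

Definition source (Y : node) (l : link Y) : node :=
  match l with Image X _ => X | Preimage X _ => X end.

Definition transport (Y : node) (l : link Y) :
    set (ty (source l)) -> set (ty Y) :=
  match l with Image _ f => fun A => f @` A | Preimage _ f => fun A => f @^-1` A end.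

(** Indexing by the source makes each domain hold by definition, so that no cast between members is
    needed. *)
Inductive arrow (Y : node) : node -> Type :=
| Arrow (k : lab Y) : arrow Y (source (links k)).

Definition arrow_map (X Y : node) (a : arrow Y X) : set (ty X) -> set (ty Y) :=
  match a in arrow _ X return set (ty X) -> set (ty Y) with
  | Arrow k => transport (l := links k)
  end.

Definition system_diagram : diagram :=
  @Diagram node ty [set Y | joins Y] (fun X Y => arrow Y X) arrow_map.

Definition value (s : forall X, set (ty X)) (Y : node) (l : link Y) : set (ty Y) :=
  transport (s (source l)).

Definition rhs (s : forall X, set (ty X)) (Y : node) : set (ty Y) :=
  if joins Y then [set y | exists k : lab Y, value s (links k) y]
  else [set y | forall k : lab Y, value s (links k) y].

Arguments rhs s Y : clear implicits.

Definition solution (s : forall X, set (ty X)) : Prop :=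
  forall Y, lab Y -> s Y = rhs s Y.

(** Arrows into [Y] correspond to labels of [Y], so unions and intersections over incoming maps
    become quantifiers over labels. *)
Lemma cross_sectionE (s : assignment system_diagram) :
  cross_section s <-> solution s.
Proof.
have cupE Y : \bigcup_(a in [set: incoming Y]) incoming_value s a =
    [set y | exists k : lab Y, value s (links k) y].
  rewrite predeqE => y; split=> [[[X [k]] _ ky]|[k ky]]; first by exists k.
  by exists (existT _ _ (Arrow k)).
have capE Y : \bigcap_(a in [set: incoming Y]) incoming_value s a =
    [set y | forall k : lab Y, value s (links k) y].
  rewrite predeqE => y; split=> [ky k|ky [X [k]] _]; last exact: ky.
  exact: (ky (existT _ _ (Arrow k))).
split=> [cs Y k|sol Y [[X [k]]]].
  have [|capY cupY] := cs Y.
    by constructor; exact: (existT _ _ (Arrow k)).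
  rewrite /rhs; case: ifPn => jY; first by rewrite cupY // cupE.
  by rewrite capY ?capE //; apply/negP.
rewrite cupE capE (sol Y k) /rhs /=.
by split=> [/negP/negbTE ->|->].
Qed.

Lemma finite_system_diagram :
  finite_set [set: node] -> finite_diagram system_diagram.
Proof.
move=> fin_node; split=> //.
have fin_lab : finite_set [set: {Y : node & lab Y}].
  have -> : [set: {Y : node & lab Y}] =
      \bigcup_(Y in [set: node]) (existT lab Y @` [set: lab Y]).
    by rewrite predeqE => -[Y k]; split=> // _; exists Y => //; exists k.
  by apply: bigcup_finite => // Y _; apply: finite_image; exact: finite_finset.
pose g (a : {Y : node & lab Y}) : {X : node & {Y : node & arrow Y X}} :=
  existT _ _ (existT _ _ (Arrow (projT2 a))).
have -> : [set: {X : didx system_diagram & {Y : _ & darr X Y}}] =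
    g @` [set: {Y : node & lab Y}].
  by rewrite predeqE => -[X [Y [k]]]; split=> // _; exists (existT _ Y k).
exact: finite_image.
Qed.

Lemma system_diagram_generated (MS : map_class) :
  (forall Y (k : lab Y),
     match links k with
     | Image _ f => generated MS f
     | Preimage _ f => generated MS f
     end) ->
  diagram_generated_by MS system_diagram.
Proof.
move=> gen X Y [k]; have := gen Y k; rewrite /=.
by case: (links k) => Z f genf; [left|right]; exists f.
Qed.

Lemma value_mono (s s' : forall X, set (ty X)) (Y : node) (l : link Y) :
  (forall X, s X `<=` s' X) -> value s l `<=` value s' l.
Proof. by move=> ss'; case: l => X f y /=; [apply: image_subset|apply: ss']. Qed.

Lemma rhs_mono (s s' : forall X, set (ty X)) (Y : node) :
  (forall X, s X `<=` s' X) -> rhs s Y `<=` rhs s' Y.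
Proof.
rewrite /rhs => ss'; case: ifP => _ y; first by case=> k /(value_mono ss'); exists k.
by move=> sy k; apply: value_mono ss' _ (sy k).
Qed.

(* Knaster-Tarski: all equations are monotone. *)
Lemma solution_exists (s0 : forall X, set (ty X)) :
  exists2 s, solution s & forall Y, (lab Y -> False) -> s Y = s0 Y.
Proof.
(* Members without labels are held constantly at [s0]; the others receive their right-hand side, so
   [F] is monotone everywhere. *)
pose F (s : forall X, set (ty X)) Y := [set y | (lab Y -> False) /\ s0 Y y]
  `|` [set y | inhabited (lab Y) /\ rhs s Y y].
have F_mono s s' Y : (forall X, s X `<=` s' X) -> F s Y `<=` F s' Y.
  move=> ss' y [?|[kY sy]]; [by left|right; split=> //].
  exact: rhs_mono ss' _ sy.
(* The intersection of all pre-fixed points of [F]. *)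
pose m Y := [set y | forall s, (forall X, F s X `<=` s X) -> s Y y].
have Fm Y : F m Y `<=` m Y.
  by move=> y Fy s Fs; apply: (Fs); apply: F_mono Fy => X x; apply.
have mF Y : m Y = F m Y.
  rewrite predeqE => y; split=> [|/Fm//]; apply=> X.
  exact: F_mono.
exists m => Y.
  move=> k; rewrite mF predeqE => y; split=> [[[/(_ k)]|[]]//|ry].
  by right; split.
move=> nk; rewrite mF predeqE => y; split=> [[[]|[[/nk]]]//|]; by left.
Qed.

(** * Well-founded dependencies and uniqueness of solutions *)

Section Uniqueness.

Variables (level : node -> nat) (rank : forall Y, ty Y -> nat).

Definition below (X Y : node) (x : ty X) (y : ty Y) : bool :=
  (level X < level Y) || (level X == level Y) && (rank x < rank y).

(** Membership of a point in the value of such a link depends only on points strictly below it, even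
    when an image has infinite fibres. *)
Definition decreasing (Y : node) (l : link Y) : Prop :=
  match l with
  | Image _ f => forall x, below x (f x)
  | Preimage _ f => forall y, below (f y) y
  end.

(** Lexicographic induction, outer on the level and inner on the rank: both solutions agree at all
    points below [y], hence so do the two right-hand sides at [y]. *)
Lemma solution_unique (s s' : forall X, set (ty X)) :
  (forall Y (k : lab Y), decreasing (links k)) ->
  solution s -> solution s' ->
  (forall Y, (lab Y -> False) -> s Y = s' Y) ->
  forall Y, s Y = s' Y.
Proof.
move=> dec sol sol' free Y; rewrite predeqE => y.
have [m] := ubnP (level Y); elim: m Y y => // m IHm Y y leYm.
have [r] := ubnP (rank y); elim: r Y y leYm => // r IHr Y y leYm leyr.
have IH X (x : ty X) : below x y -> s X x <-> s' X x.
  case/orP=> [ltXY|/andP[/eqP eqXY ltxy]].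
    by apply: IHm; exact: leq_trans ltXY leYm.
  by apply: IHr; [rewrite eqXY|exact: leq_trans ltxy leyr].
have valE (k : lab Y) : value s (links k) y <-> value s' (links k) y.
  have := dec Y k; case: (links k) => X f /= df; last by apply: IH; exact: df.
  by split=> -[x sx fx]; exists x => //; apply/(IH X x) => //; rewrite -fx.
have [[k]|nk] := pselect (inhabited (lab Y)); last first.
  by rewrite free // => k; apply: nk.
rewrite (sol Y k) (sol' Y k) /rhs; case: ifP => _.
  by split=> -[k' /valE]; exists k'.
by split=> sy k'; apply/valE.
Qed.

End Uniqueness.

End System.
Arguments rhs {node ty lab} joins links s Y.
Arguments Image {node ty Y} X & f.
Arguments Preimage {node ty Y} X & f.

(** * The equations that simulate a Turing machine *)

Section Simulation.

Variable M : turing_machine.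

Let sym := tm_sym M.
Let state := tm_state M.
Implicit Types (tau : seq bool) (x y : sym) (p q : state).

Definition halting q : bool := (q == tm_accept M) || (q == tm_reject M).

(* [None] stands for the absence of a move in a halting state. *)
Definition next y q : sym * state * option direction :=
  if halting q then (y, q, None)
  else let: (x, p, d) := tm_delta (y, q) in (x, p, Some d).

Definition move (d : option direction) (i : nat) : nat :=
  match d with None => i | Some Left => i.-1 | Some Right => i.+1 end.

Lemma stepE (c : config M) (a := next (c_tape c (c_head c)) (c_state c)) :
  [/\ c_state (step c) = a.1.2,
      c_head (step c) = move a.2 (c_head c)
    & c_tape (step c) =1
        fun i => if i == c_head c then a.1.1 else c_tape c i].
Proof.
rewrite /a /step /next /halted /halting; case: ifP => _.
  by split=> // i; case: eqP => [->|].
by case: tm_delta => -[x p] d; split; case: d.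
Qed.

(* The first component of a point of [nat * nat] is a time and the second one
   a position, except at [Less], [Diff], [LessEnd], [EndLess] (pairs of
   positions) and at [Inp], [Out] (encoded strings).  A point [(t, i, j)] of
   [HeadAway3] is a time, a position and the position of the head. *)
Inductive node : Type :=
| One | Inp | All | Less | Diff | Empty | End | LessEnd | EndLess | Before
| From | Bit of bool
| Cell of sym | Head of state | AnyHead | HeadAway3 | HeadAway | Keep of sym
| Read of sym & state | Read0 of sym & state | ReadS of sym & state
| Accept | Final of sym | FinalNext | FinalEnd | Out.

Definition ty (Y : node) : Type :=
  match Y with
  | One => unit
  | All | End | Before | From | Bit _ | Read0 _ _ | Accept => nat
  | HeadAway3 => nat * nat * nat
  | _ => nat * nat
  end%type.

Definition joins (Y : node) : bool :=
  match Y with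
  | Empty | End | LessEnd | EndLess | Bit _ | HeadAway3 | Keep _ | Read _ _
  | Final _ | FinalEnd => false
  | _ => true
  end.

Definition lab (Y : node) : finType :=
  match Y with
  | One | Inp => void
  | All | Before | HeadAway | Read0 _ _ | ReadS _ _ | Accept => unit
  | Cell _ => (option bool + option (sym * state))%type
  | Head _ => option (sym * state * bool)
  | AnyHead => state
  | FinalNext => option bool
  | Out => (bool + bool)%type
  | _ => bool
  end.

Definition tick (z : nat * nat) : nat * nat := (z.1.+1, z.2).

Definition either (Y : node) (l l' : link ty Y) (k : bool) : link ty Y :=
  if k then l else l'.
Arguments either {Y} & l l' k.

(* Failed side conditions yield a copy of [Empty] instead of no link, since a
   member without incoming maps would be unconstrained. *)
Definition links (Y : node) : lab Y -> link ty Y :=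
  match Y return lab Y -> link ty Y with
  | One | Inp => fun k => match k with end
  | All => fun _ => Preimage One (fun _ => tt)
  (* The points [(0, i + 1)] generate the strict order under the diagonal shift. *)
  | Less => either (Image All (fun i => (0, i.+1)))
      (Image Less (fun z => (z.1.+1, z.2.+1)))
  | Diff => either (Image Less id)
      (Image Less (fun z => (z.2, z.1)))
  (* The links of [Diff], intersected instead of united: the order and its converse are disjoint. *)
  | Empty => either (Image Less id)
      (Image Less (fun z => (z.2, z.1)))
  | End => either (Preimage Inp (fun i => (i, 1)))
      (Preimage Inp (fun i => (i, 0)))
  | LessEnd => either (Preimage Less id)
      (Preimage End snd)
  | EndLess => either (Preimage Less id)
      (Preimage End fst)
  | Before => fun _ => Image LessEnd fst
  | From => either (Image End id)
      (Image EndLess snd)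
  (* For an encoded input, [Before] excludes the end position, which carries both bits. *)
  | Bit b => either (Preimage Before id)
      (either (Preimage Inp (fun i => (i, 1)))
        (Preimage Inp (fun i => (i, 0))) b)
  | Cell x => fun k =>
      match k return link ty (Cell x) with
      | inl (Some b) =>
          either (Image (Bit b) (fun i => (0, i))) (Image Empty id) (tm_bit M b == x)
      | inl None =>
          either (Image From (fun i => (0, i))) (Image Empty id) (tm_blank M == x)
      | inr None => Image (Keep x) tick
      | inr (Some (y, q)) =>
          either (Image (Read y q) tick) (Image Empty id) ((next y q).1.1 == x)
      end
  | Head p => fun k =>
      match k return link ty (Head p) with
      | None =>
          either (Image One (fun _ => (0, 0))) (Image Empty id) (tm_start M == p)
      (* The bit [b] splits a left move: [ReadS] covers a positive head position, lowered by a
         preimage of the successor, and [Read0] covers cell 0, where the head stays. *)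
      | Some (y, q, b) =>
          either
            match (next y q).2 return link ty (Head p) with
            | None => Image (Read y q) tick
            | Some Right => Image (Read y q) (fun z => (z.1.+1, z.2.+1))
            | Some Left =>
                either (Image (ReadS y q) tick)
                  (Image (Read0 y q) (fun t => (t.+1, 0))) b
            end
            (Image Empty id) ((next y q).1.2 == p)
      end
  | AnyHead => fun q => Image (Head q) id
  (* The triples add the head position as a coordinate, to be compared with the cell position by
     [Diff] and then projected away in [HeadAway]. *)
  | HeadAway3 => either (Preimage AnyHead (fun w => (w.1.1, w.2)))
      (Preimage Diff (fun w => (w.1.2, w.2)))
  | HeadAway => fun _ => Image HeadAway3 fst
  | Keep x => either (Preimage (Cell x) id)
      (Preimage HeadAway id)
  | Read y q => either (Preimage (Cell y) id)
      (Preimage (Head q) id)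
  | Read0 y q => fun _ => Preimage (Read y q) (fun t => (t, 0))
  | ReadS y q => fun _ => Preimage (Read y q) (fun z => (z.1, z.2.+1))
  | Accept => fun _ => Image (Head (tm_accept M)) fst
  | Final x => either (Preimage (Cell x) id)
      (Preimage Accept fst)
  (* Position 0 and the right neighbours of bits: a blank at such a position ends the output
     string. *)
  | FinalNext => fun k =>
      match k return link ty FinalNext with
      | None => Image Accept (fun t => (t, 0))
      | Some b => Image (Final (tm_bit M b)) (fun z => (z.1, z.2.+1))
      end
  | FinalEnd => either (Preimage (Final (tm_blank M)) id)
      (Preimage FinalNext id)
  | Out => fun k =>
      match k return link ty Out with
      | inl true => Image (Final (tm_bit M true)) (fun z => (z.2, 1))
      | inl false => Image (Final (tm_bit M false)) (fun z => (z.2, 0))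
      | inr true => Image FinalEnd (fun z => (z.2, 1))
      | inr false => Image FinalEnd (fun z => (z.2, 0))
      end
  end.

Definition simulation : diagram := system_diagram joins links.

Lemma finite_node : finite_set [set: node].
Proof.
(* There are 26 constructors; each picks its parameters from the same finite product. *)
pose f (a : 'I_26 * bool * sym * state) : node :=
  let: (k, b, x, q) := a in
  nth One [:: One; Inp; All; Less; Diff; Empty; End; LessEnd; EndLess; Before;
    From; Bit b; Cell x; Head q; AnyHead; HeadAway3; HeadAway; Keep x;
    Read x q; Read0 x q; ReadS x q; Accept; Final x; FinalNext; FinalEnd; Out] k.
have -> : [set: node] = f @` setT; last first.
  by apply: finite_image; exact: finite_finset.
rewrite predeqE => Y; split=> // _.
pose x0 := tm_blank M; pose q0 := tm_start M.
have mk k b x q (lt_k : k < 26) : f (Ordinal lt_k, b, x, q) = Y ->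
    exists2 a, True & f a = Y by exists (Ordinal lt_k, b, x, q).
case: Y mk => [||||||||||| b | x | q |||| x | x q | x q | x q || x |||] mk;
  [ exact: (mk 0 true x0 q0) | exact: (mk 1 true x0 q0)
  | exact: (mk 2 true x0 q0) | exact: (mk 3 true x0 q0)
  | exact: (mk 4 true x0 q0) | exact: (mk 5 true x0 q0)
  | exact: (mk 6 true x0 q0) | exact: (mk 7 true x0 q0)
  | exact: (mk 8 true x0 q0) | exact: (mk 9 true x0 q0)
  | exact: (mk 10 true x0 q0) | exact: (mk 11 b x0 q0)
  | exact: (mk 12 true x q0) | exact: (mk 13 true x0 q)
  | exact: (mk 14 true x0 q0) | exact: (mk 15 true x0 q0)
  | exact: (mk 16 true x0 q0) | exact: (mk 17 true x q0)
  | exact: (mk 18 true x q) | exact: (mk 19 true x q)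
  | exact: (mk 20 true x q) | exact: (mk 21 true x0 q0)
  | exact: (mk 22 true x q0) | exact: (mk 23 true x0 q0)
  | exact: (mk 24 true x0 q0) | exact: (mk 25 true x0 q0) ].
Qed.

Ltac generate :=
  first
  [ exact: gen_id | exact: gen_omega | exact: gen_fst | exact: gen_snd
  | match goal with
    | |- generated _ (fun w => (@?f w, @?g w)) =>
        apply: (@gen_pair _ _ _ _ f g); generate
    | |- generated _ (fun w => S (@?f w)) =>
        apply: (@gen_comp _ _ _ _ f succn);
        [generate | exact: gen_base M_N_succ]
    | |- generated _ (fun w => 0) =>
        apply: (@gen_comp _ _ _ _ (fun _ => tt) (fun _ => 0));
        [generate | exact: gen_base M_N_zero]
    | |- generated _ (fun w => (@?f w).1) =>
        apply: (@gen_comp _ _ _ _ f fst); generate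
    | |- generated _ (fun w => (@?f w).2) =>
        apply: (@gen_comp _ _ _ _ f snd); generate
    end ].

Ltac split_label k :=
  hnf in k;
  lazymatch type of k with
  | void => destruct k
  | bool => destruct k
  | unit => destruct k
  | option _ => destruct k as [k|]; [split_label k|]
  | sum _ _ => destruct k as [k|k]; split_label k
  | prod _ _ => let l := fresh "l" in
      destruct k as [k l]; split_label k; split_label l
  | _ => idtac
  end.

Ltac split_links Y k :=
  case: Y k => [||||||||||| b | x | p |||| x | x q | x q | x q || x |||] k;
  split_label k; rewrite /links /either /tick;
  repeat match goal with
  | |- context [if ?b then _ else _] => case: b
  | |- context [match ?d with Some _ => _ | None => _ end] => case: d => [[]|]
  end.

Lemma simulation_generated : diagram_generated_by M_N simulation.
Proof. by apply: system_diagram_generated => Y k; split_links Y k; generate. Qed.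

(* Levels are needed besides ranks: the projection onto [Out] forgets time, and
   the one onto [Before] forgets an unbounded position. *)
Definition level (Y : node) : nat :=
  match Y with
  | One | Inp => 0
  | All | End => 1
  | Less => 2
  | Diff | Empty => 3
  | LessEnd | EndLess => 3
  | Before | From => 4
  | Bit _ => 5
  | Cell _ | Head _ | AnyHead | HeadAway3 | HeadAway | Keep _
  | Read _ _ | Read0 _ _ | ReadS _ _ => 6
  | Accept => 7
  | Final _ => 8
  | FinalNext => 9
  | FinalEnd => 10
  | Out => 11
  end.

(** The factor 5 leaves room for the chain inside one time step: [Cell] and [Head] at offset 0, then
    up to [Keep] at offset 4, which feeds [Cell] at the next time. *)
Definition rank (Y : node) : ty Y -> nat :=
  match Y return ty Y -> nat with
  | Less => fun z => z.1
  | Cell _ | Head _ => fun z => z.1 * 5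
  | Read _ _ => fun z => z.1 * 5 + 1
  | Read0 _ _ => fun t => t * 5 + 2
  | ReadS _ _ => fun z => z.1 * 5 + 2
  | AnyHead => fun z => z.1 * 5 + 1
  | HeadAway3 => fun w => w.1.1 * 5 + 2
  | HeadAway => fun z => z.1 * 5 + 3
  | Keep _ => fun z => z.1 * 5 + 4
  | _ => fun _ => 0
  end.

Lemma links_decreasing (Y : node) (k : lab Y) : decreasing level rank (links k).
Proof.
split_links Y k; move=> z; rewrite /below /= ?mulSn ?[5 + _]addnC ?ltn_add2l //.
all: by rewrite -[X in X < _]addn0 ltn_add2l.
Qed.

(** Only [One] and [Inp] have no label, so agreement there determines a solution. *)
Lemma solution_out_unique (s s' : forall Y, set (ty Y)) :
  solution joins links s -> solution joins links s' ->
  s One = s' One -> s Inp = s' Inp -> s Out = s' Out.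
Proof.
move=> sol sol' s1 sI; apply: (solution_unique links_decreasing sol sol') => Y.
case: Y => [||||||||||| b | x | p |||| x | x q | x q | x q || x |||] nk //;
  exfalso; apply: nk;
  by [exact: true | exact: tt | exact: None | exact: (tm_start M)
     | exact: (inr None) | exact: (inr true)].
Qed.

(** * The space-time trace of an actual run *)

Section Run.

Variable sigma : seq bool.

Let st t := c_state (run M sigma t).
Let hd t := c_head (run M sigma t).
Let tp t i := c_tape (run M sigma t) i.
Let acc t := st t = tm_accept M.
Let follows t i :=
  i = 0 \/ exists j b, i = j.+1 /\ tp t j = tm_bit M b.

(** The intended value of each member, phrased to follow the shape of its equation, so that several
    equations hold by conversion. *)
Definition trace (Y : node) : set (ty Y) :=
  match Y return set (ty Y) with
  | One => setT
  | Inp => encode sigma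
  | All => setT
  | Less => [set z | z.1 < z.2]
  | Diff => [set z | z.1 != z.2]
  | Empty => set0
  | End => [set i | i = size sigma]
  | LessEnd => [set z | z.1 < z.2 /\ z.2 = size sigma]
  | EndLess => [set z | z.1 < z.2 /\ z.1 = size sigma]
  | Before => [set i | i < size sigma]
  | From => [set i | size sigma <= i]
  | Bit b => [set i | i < size sigma /\ nth false sigma i = b]
  | Cell x => [set z | tp z.1 z.2 = x]
  | Head q => [set z | st z.1 = q /\ hd z.1 = z.2]
  | AnyHead => [set z | hd z.1 = z.2]
  | HeadAway3 => [set w | hd w.1.1 = w.2 /\ w.1.2 != w.2]
  | HeadAway => [set z | hd z.1 != z.2]
  | Keep x => [set z | tp z.1 z.2 = x /\ hd z.1 != z.2]
  | Read y q => [set z | tp z.1 z.2 = y /\ (st z.1 = q /\ hd z.1 = z.2)]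
  | Read0 y q => [set t | tp t 0 = y /\ (st t = q /\ hd t = 0)]
  | ReadS y q =>
      [set z | tp z.1 z.2.+1 = y /\ (st z.1 = q /\ hd z.1 = z.2.+1)]
  | Accept => [set t | acc t]
  | Final x => [set z | tp z.1 z.2 = x /\ acc z.1]
  | FinalNext => [set z | acc z.1 /\ follows z.1 z.2]
  | FinalEnd => [set z | (tp z.1 z.2 = tm_blank M /\ acc z.1) /\
                         (acc z.1 /\ follows z.1 z.2)]
  | Out => [set z |
      (exists t b, (tp t z.1 = tm_bit M b /\ acc t) /\ z.2 = nat_of_bool b) \/
      (exists t (b : bool),
         ((tp t z.1 = tm_blank M /\ acc t) /\ (acc t /\ follows t z.1)) /\
         z.2 = nat_of_bool b)]
  end.

Arguments trace Y : clear implicits.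

Lemma cellS t i :
  tp t.+1 i = if i == hd t then (next (tp t (hd t)) (st t)).1.1 else tp t i.
Proof. by rewrite /tp /run iterS; have [_ _ ->] := stepE (run M sigma t). Qed.

Lemma headS t : hd t.+1 = move (next (tp t (hd t)) (st t)).2 (hd t).
Proof. by rewrite /hd /run iterS; have [_ -> _] := stepE (run M sigma t). Qed.

Lemma stateS t : st t.+1 = (next (tp t (hd t)) (st t)).1.2.
Proof. by rewrite /st /run iterS; have [-> _ _] := stepE (run M sigma t). Qed.

(** The disjuncts mirror the two sources of a cell at time 0, [Bit b] and [From]. *)
Lemma tape0E i x :
  tp 0 i = x <->
  (exists b, (i < size sigma /\ nth false sigma i = b) /\ tm_bit M b = x) \/
  (size sigma <= i /\ tm_blank M = x).
Proof.
rewrite /tp /= /tape_of; case: ltnP => lei; split.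
- by move=> <-; left; exists (nth false sigma i).
- by case=> [[b [[_ <-] <-]]|[]].
- by right.
- by case=> [[b [[]]]|[]].
Qed.

Lemma trace_cell x : trace (Cell x) = rhs joins links trace (Cell x).
Proof.
rewrite predeqE => -[t i]; split=> [|[]]; last first.
  case=> [[b|]|[[y q]|]]; rewrite /value /= /either.
  - case: eqP => [bx|_] [u] //= [ltu ub] [<- <-].
    by apply/tape0E; left; exists b.
  - case: eqP => [bx|_] [u] //= ltu [<- <-].
    by apply/tape0E; right.
  - case: eqP => [yx|_] [[u j]] //= [tpy [stq hdj]] [<- <-].
    by rewrite cellS hdj eqxx stq tpy.
  - case=> [[u j]] /= [tpx hdj] [<- <-].
    by rewrite cellS eq_sym (negbTE hdj).
case: t => [/tape0E[[b [ib bx]]|[lei bx]]|t] /=.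
- by exists (inl (Some b)); rewrite /value /= /either bx eqxx; exists i.
- by exists (inl None); rewrite /value /= /either bx eqxx; exists i.
rewrite cellS; case: eqP => [->|/eqP ih] tpx.
  exists (inr (Some (tp t (hd t), st t))).
  by rewrite /value /= /either tpx eqxx; exists (t, hd t).
by exists (inr None); exists (t, i) => //; split=> //=; rewrite eq_sym.
Qed.

Lemma trace_head p : trace (Head p) = rhs joins links trace (Head p).
Proof.
rewrite predeqE => -[t i]; split=> [|[]]; last first.
  case=> [[[y q] b]|]; rewrite /value /= /either; last first.
    by case: eqP => [bx|_] [u] //= _ [<- <-].
  case: eqP => [yx|_]; last by case.
  case E : (next y q).2 => [[]|] /=.
  - case: b => /= -[].
      by case=> u j /= [tpy [stq hdj]] [<- <-]; rewrite stateS headS hdj tpy stq E.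
    by move=> u /= [tpy [stq hdj]] [<- <-]; rewrite stateS headS hdj tpy stq E.
  - by case=> -[u j] /= [tpy [stq hdj]] [<- <-]; rewrite stateS headS hdj tpy stq E.
  - by case=> -[u j] /= [tpy [stq hdj]] [<- <-]; rewrite stateS headS hdj tpy stq E.
case: t => [[/= sp hi]|t /= []].
  by exists None; rewrite /value /= /either -sp eqxx; exists tt => //; rewrite -hi.
rewrite stateS headS => sp hi.
(* The last component selects [ReadS] or [Read0] when the move is to the left. *)
exists (Some (tp t (hd t), st t, hd t != 0)).
rewrite /value /= /either sp eqxx.
move: hi; case: (next _ _).2 => [[]|] /= <-.
- by case E : (hd t) => [|j] /=; [exists t|exists (t, j)]; rewrite // E.
- by exists (t, hd t).
- by exists (t, hd t).
Qed.

Lemma trace_solution : solution joins links trace.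
Proof.
have exists_unit (P : unit -> Prop) : (exists u, P u) <-> P tt.
  by split=> [[[]]|]; [|exists tt].
move=> Y k; case: Y k =>
  [[]|[]|||||||||| b | x | p |||| x | x q | x q | x q || x |||] _;
  try exact: trace_cell; try exact: trace_head;
  rewrite predeqE => z;
  rewrite /rhs /value /= ?exists_bool ?forall_bool ?exists_unit /=;
  try exact: iff_refl.
- case: z => [[|i] j] /=; split.
  + by case: j => // j _; left; exists j.
  + by case=> [[u _ [<-]]|[[u v] _ []]].
  + by case: j => // j ltij; right; exists (i, j).
  + by case=> [[u _ []]|[[u v] /= ltuv [<- <-]]].
- case: z => i j; rewrite /= neq_ltn; split.
    by case/orP=> [ltij|ltji]; [left; exists (i, j)|right; exists (j, i)].
  by case=> -[[u v] /= ltuv [<- <-]]; rewrite ltuv ?orbT.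
- split=> // -[[[u v] /= ltuv <-] [[u' v'] /= ltuv' [ev eu]]].
  by move: ltuv'; rewrite ev eu ltnNge ltnW.
(* The equation of [End]: a position carrying both bits cannot lie inside the string. *)
- rewrite -[1]/(nat_of_bool true) -[0]/(nat_of_bool false) !encodeE.
  by split=> [|[[[_ ->]|//] [[]|]]] //; split; right.
- by split=> [ltzn|[[u v] /= [ltuv <-] <-]] //; exists (z, size sigma).
- split=> [|[[u /= -> <-]|[[u v] /= [ltuv eu] <-]]] //; last by rewrite -eu ltnW.
  rewrite leq_eqVlt => /predU1P[->|ltnz]; first by left; exists z.
  by right; exists (size sigma, z).
- have -> : transport (trace (source (@links (Bit b) false))) z = encode sigma (z, nat_of_bool b).
    by rewrite /=; case: (b).
  rewrite encodeE; split=> [[]|[ltz [[]|ez]]] //; first by split=> //; left.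
  by rewrite ez ltnn in ltz.
- case: z => t i; split=> [hdt|[q [[u v] /= [_ huv] [<- <-]]]] //.
  by exists (st t); exists (t, i).
- case: z => t i; split=> [hdt|[[[u v] w] /= [<- neq] [<- <-]]].
    by exists (t, i, hd t) => //; rewrite eq_sym.
  by rewrite eq_sym.
- split=> [accz|[[u v] /= [accu _] <-]] //.
  by exists (z, hd z).
- case: z => t i; split=> /= [[acct [->|[j [b [-> tpj]]]]]|].
  + by exists None; exists t.
  + by exists (Some b); exists (t, j).
  + case=> -[b [[u v] /= [tpv accu] [<- <-]]|[u /= accu [<- <-]]]; split=> //.
      by right; exists v, b.
    by left.
- case: z => i c; split=> /= [[] [t [b [tpt ->]]]|].
  + by exists (inl b); case: b tpt => tpt; exists (t, i).
  + by exists (inr b); case: b; exists (t, i).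
  + case=> -[] [] [[t j] /= tpt [<- <-]].
    * by left; exists t, true.
    * by left; exists t, false.
    * by right; exists t, true.
    * by right; exists t, false.
Qed.

(** * Reading the output off the halted run *)

Lemma run_halted n t :
  halted (run M sigma n) -> halted (run M sigma t) -> run M sigma n = run M sigma t.
Proof.
have stop k l : halted (run M sigma l) -> run M sigma (k + l) = run M sigma l.
  move=> hl; elim: k => // k IHk.
  by rewrite addSn {1}/run iterS -/(run _ _ _) IHk /step hl.
by move=> hn ht; rewrite -(stop t n hn) addnC stop.
Qed.

Lemma acc_halted t : acc t -> halted (run M sigma t).
Proof. by rewrite /acc /st /halted => ->; rewrite eqxx. Qed.

(** [Out] collects bits from all accepting times, but halted configurations are fixed, so every such
    time shows the same tape [tau]. *)
Lemma trace_accept tau : accepts_leaving M sigma tau -> trace Out = encode tau.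
Proof.
case=> n [accn tpn].
have tpE t i : acc t -> tp t i = tape_of M tau i.
  move=> acct; rewrite /tp -tpn; congr (c_tape _ _).
  by apply: run_halted; exact: acc_halted.
have bitE t i b : acc t ->
    tp t i = tm_bit M b <-> i < size tau /\ nth false tau i = b.
  move/tpE->; rewrite /tape_of; case: ifP => _.
    by split=> [/(@tm_bit_inj M)|[_ ->]].
  by split=> [/esym/tm_blankP|[]].
have blankE t i : acc t -> tp t i = tm_blank M <-> size tau <= i.
  by move/tpE->; rewrite /tape_of; case: ltnP => // _; split=> // /tm_blankP.
rewrite predeqE => -[i c]; split.
  case=> -[t [b]] /=.
    by case=> -[/[swap] acct] /(bitE _ _ _ acct) ib ->; apply/encodeE; left.
  case=> -[[/[swap] acct] /(blankE _ _ acct) leti [_ fol]] ->.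
  (* The blank gives [size tau <= i]; being 0 or next to a bit gives the converse inequality. *)
  apply/encodeE; right; apply/eqP; rewrite eqn_leq leti andbT.
  by case: fol => [->|[j [d [-> /(bitE _ _ _ acct) []]]]].
move=> ic; have [b cb] := encode_snd ic; rewrite cb in ic *.
case/encodeE: ic => [ib|->].
  by left; exists n, b; split=> //; split=> //; apply/bitE.
right; exists n, b; split=> //; split; first by split=> //; apply/blankE.
(* An empty [tau] ends at position 0; otherwise its last bit precedes the end. *)
split=> //; case tauE : (size tau) => [|j]; [by left|right].
by exists j, (nth false tau j); split=> //; apply/bitE => //; rewrite tauE.
Qed.

(** Every point of [Out] is witnessed by an accepting time, which would be a halting time and, on
    rejection, force the accept and reject states to coincide. *)
Lemma trace_nonaccept :
  rejects M sigma \/ does_not_terminate M sigma -> trace Out = set0.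
Proof.
move=> nM; have nacc t : ~ acc t.
  move=> acct; have ht := acc_halted acct; case: nM => [[n rejn]|/(_ t)/negP//].
  have hn : halted (run M sigma n) by rewrite /halted rejn eqxx orbT.
  by apply: (@tm_accept_neq_reject M); rewrite -rejn (run_halted hn ht).
by rewrite predeqE => z; split=> // -[[t [b [[_ /nacc]]]]|[t [b [[_ [/nacc]]]]]].
Qed.

End Run.

End Simulation.
Arguments trace {M} sigma Y.

(** * The map represented by the simulating diagram *)

Theorem theorem1 (M : turing_machine) :
  exists (D : diagram) (one : member D unit) (S T : member D (nat * nat)),
    [/\ finite_diagram D,
        diagram_generated_by M_N D,
        midx S <> midx T
      & exists Mbar : set (nat * nat) -> set (nat * nat),
          [/\ represents one S T Mbar,
              (* not implied by [represents], which is vacuous for a diagram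
                 without cross sections *)
              (forall A : set (nat * nat),
                 exists2 s, sections_with_one one s & value_at s S = A),
              (forall sigma tau : seq bool,
                 accepts_leaving M sigma tau ->
                 Mbar (encode sigma) = encode tau)
            & (forall sigma : seq bool,
                 rejects M sigma \/ does_not_terminate M sigma ->
                 Mbar (encode sigma) = set0)]].
Proof.
pose D := simulation M; pose one := @Member D unit (One M) erefl.
pose S := @Member D (nat * nat)%type (Inp M) erefl.
pose T := @Member D (nat * nat)%type (Out M) erefl.
(* The union of the outputs over all cross sections with input [A]; by uniqueness they all have the
   same output. *)
pose Mbar (A : set (nat * nat)) : set (nat * nat) :=
  [set z | exists2 s, sections_with_one one s & value_at s S = A /\ value_at s T z].
have MbarE s : sections_with_one one s -> value_at s T = Mbar (value_at s S).
  move=> sec_s; rewrite predeqE => z; split=> [sz|[s' [cs' s'1] [s'S]]].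
    by exists s.
  have [cs s1] := sec_s.
  suff /= <- : value_at s' T = value_at s T by [].
  apply: solution_out_unique; [exact/cross_sectionE|exact/cross_sectionE| |] => //.
  exact: etrans s'1 (esym s1).
have MbarT sigma : Mbar (encode sigma) = trace sigma (Out M).
  apply/esym/(MbarE (trace sigma)); split=> //.
  by apply/cross_sectionE; exact: trace_solution.
exists D, one, S, T; split=> //.
- exact/finite_system_diagram/finite_node.
- exact: simulation_generated.
exists Mbar; split=> // [A|sigma tau acc|sigma rej].
(* Prescribes [A] at [Inp] and the full set at [One], the two members that [solution_exists] leaves
   free. *)
- pose s0 (Y : node M) : set (ty Y) :=
    match Y return set (ty Y) with Inp => A | _ => setT end.
  have [s sol free] := solution_exists (@joins M) (@links M) s0.
  exists s; last by apply: (free (Inp M)) => -[].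
  by split; [apply/cross_sectionE|apply: (free (One M)) => -[]].
- by rewrite MbarT; exact: trace_accept.
- by rewrite MbarT; exact: trace_nonaccept.
Qed.
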